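(* Let $\mathbf K\in\mathbb R^{N\times N}$ satisfy $\|\mathbf K\|_2=\kappa<1$, let $\boldsymbol\phi\in\mathbb R^N$, and let $\mathbf U=(\mathbf I-\mathbf K)^{-1}\boldsymbol\phi$ be the full-order density. Let $\mathcal R\in\mathbb R^{N\times r}$ satisfy $\mathcal R^\top\mathcal R=I_r$, let $\widehat U=\mathcal R c$ be the Galerkin reduced-order solution, where $c\in\mathbb R^r$ solves $\mathcal R^\top(\mathbf I-\mathbf K)\mathcal R\,c=\mathcal R^\top\boldsymbol\phi$, and let $\Pi=\mathcal R\mathcal R^\top$ be the orthogonal projector onto the reduced space. Then $$\|\mathbf U-\widehat U\|_2\le\frac{1+\kappa}{1-\kappa}\,\|\mathbf U-\Pi\mathbf U\|_2 .$$
   Context: $\|\cdot\|_2$ is the Euclidean norm on vectors and the induced operator norm on matrices. In the paper, $\mathbf K$ is the full-order discretization of a contractive second-kind Fredholm integral operator, $\kappa$ is its discrete contraction constant, and the columns of $\mathcal R$ form a POD basis. *)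

(* Defs.v *)
From HB Require Import structures.
From mathcomp Require Import all_boot all_order all_algebra.
From mathcomp Require Import all_classical all_reals.

Set Implicit Arguments.
Unset Strict Implicit.
Unset Printing Implicit Defensive.

Import Order.TTheory GRing.Theory Num.Theory.

Local Open Scope classical_set_scope.
Local Open Scope ring_scope.

(* The library's norm `|x| on matrices is the max norm, hence this definition. *)
Definition norm2 (R : realType) (n : nat) (x : 'cV[R]_n) : R :=
  Num.sqrt (\sum_(i < n) x i 0 ^+ 2).

(* The supremum is over the closed unit ball rather than the unit sphere, so
   that the set is nonempty also when n = 0; it is bounded for every A. *)
Definition opnorm2 (R : realType) (m n : nat) (A : 'M[R]_(m, n)) : R :=
  sup [set norm2 (A *m x) | x in [set x : 'cV[R]_n | norm2 x <= 1]].

(* Main.v *)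
Require Import Defs.
From mathcomp Require Import all_boot all_order all_algebra.
From mathcomp Require Import all_classical all_reals.
From mathcomp Require Import ring lra.

Import Order.TTheory GRing.Theory Num.Theory.

(** Write [a = U - Uhat] for the error.  As [kappa < 1], the matrix [1 - K] has
    trivial kernel ([contraction_unitmx]), so [(1 - K) U = phi], and the reduced
    equation becomes the Galerkin orthogonality [B^T (1 - K) a = 0].  Hence
    [Pi a = Pi K a].  Since [Uhat] lies in the range of [B], the complementary
    component of [a] is [a - Pi a = U - Pi U], so [a = (U - Pi U) + Pi K a].
    The orthogonal projector [Pi] does not increase the norm
    ([norm2_proj_le]) and [K] contracts it by [kappa] ([norm2_mulmx_le]), whence
    [(1 - kappa) * norm2 a <= norm2 (U - Pi U)].  This is the claimed bound with
    the better constant [1 / (1 - kappa)]; it only remains to use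
    [0 <= kappa]. *)

Local Open Scope ring_scope.

(** The Euclidean inner product of two column vectors, as a [1 x 1] matrix
    product, so that bilinearity is that of [mulmx]. *)
Definition dotv {R : realType} {n : nat} (x y : 'cV[R]_n) : R := (x^T *m y) 0 0.

Lemma dotvC {R : realType} {n : nat} (x y : 'cV[R]_n) : dotv x y = dotv y x.
Proof. by rewrite /dotv -[in LHS](trmxK (x^T *m y)) trmx_mul trmxK mxE. Qed.

Lemma dotvDr {R : realType} {n : nat} (x y z : 'cV[R]_n) :
  dotv x (y + z) = dotv x y + dotv x z.
Proof. by rewrite /dotv mulmxDr mxE. Qed.

Lemma dotvZr {R : realType} {n : nat} (a : R) (x y : 'cV[R]_n) :
  dotv x (a *: y) = a * dotv x y.
Proof. by rewrite /dotv -scalemxAr mxE. Qed.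

Lemma dotvDl {R : realType} {n : nat} (x y z : 'cV[R]_n) :
  dotv (x + y) z = dotv x z + dotv y z.
Proof. by rewrite dotvC dotvDr !(dotvC z). Qed.

Lemma dotvZl {R : realType} {n : nat} (a : R) (x y : 'cV[R]_n) :
  dotv (a *: x) y = a * dotv x y.
Proof. by rewrite dotvC dotvZr dotvC. Qed.

Lemma dotv_sum {R : realType} {n : nat} (x y : 'cV[R]_n) :
  dotv x y = \sum_(i < n) x i 0 * y i 0.
Proof. by rewrite /dotv mxE; apply: eq_bigr => i _; rewrite mxE. Qed.

Lemma dotvv {R : realType} {n : nat} (x : 'cV[R]_n) :
  dotv x x = \sum_(i < n) x i 0 ^+ 2.
Proof. by rewrite dotv_sum; apply: eq_bigr => i _; rewrite expr2. Qed.

Lemma dotvv_ge0 {R : realType} {n : nat} (x : 'cV[R]_n) : 0 <= dotv x x.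
Proof. by rewrite dotvv sumr_ge0 // => i _; rewrite sqr_ge0. Qed.

Lemma norm2_ge0 {R : realType} {n : nat} (x : 'cV[R]_n) : 0 <= norm2 x.
Proof. exact: sqrtr_ge0. Qed.

Lemma sqr_norm2 {R : realType} {n : nat} (x : 'cV[R]_n) :
  norm2 x ^+ 2 = dotv x x.
Proof. by rewrite /norm2 -dotvv sqr_sqrtr // dotvv_ge0. Qed.

Lemma norm2_eq0 {R : realType} {n : nat} (x : 'cV[R]_n) : norm2 x = 0 -> x = 0.
Proof.
move=> x0; have /eqP := sqr_norm2 x; rewrite x0 expr0n dotvv eq_sym.
rewrite psumr_eq0 => [/allP xi0|i _]; last exact: sqr_ge0.
apply/matrixP => i j; rewrite ord1 mxE.
by apply/eqP; rewrite -sqrf_eq0; exact: implyP (xi0 i (mem_index_enum i)) _.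
Qed.

Lemma norm20 {R : realType} {n : nat} : norm2 (0 : 'cV[R]_n) = 0.
Proof. by apply/eqP; rewrite -sqrf_eq0 sqr_norm2 /dotv mulmx0 mxE. Qed.

Lemma norm2Z {R : realType} {n : nat} (a : R) (x : 'cV[R]_n) :
  0 <= a -> norm2 (a *: x) = a * norm2 x.
Proof.
move=> a0; apply/eqP; rewrite -(@eqrXn2 _ 2) ?mulr_ge0 ?norm2_ge0 //.
by rewrite exprMn !sqr_norm2 dotvZl dotvZr mulrA.
Qed.

(** Cauchy-Schwarz inequality. *)
Lemma dotv_le {R : realType} {n : nat} (x y : 'cV[R]_n) :
  dotv x y <= norm2 x * norm2 y.
Proof.
have [/norm2_eq0 ->|y0] := eqVneq (norm2 y) 0.
  by rewrite norm20 mulr0 /dotv mulmx0 mxE.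
have yy_gt0 : 0 < dotv y y by rewrite -sqr_norm2 exprn_even_gt0.
apply: le_trans (ler_norm _) _.
rewrite -(@ler_pXn2r _ 2) ?nnegrE ?mulr_ge0 ?norm2_ge0 //.
rewrite real_normK ?num_real // exprMn !sqr_norm2.
(* positivity of the component of x orthogonal to y, scaled by dotv y y *)
have := dotvv_ge0 (dotv y y *: x + (- dotv x y) *: y).
rewrite !(dotvDl, dotvDr, dotvZl, dotvZr) (dotvC y x) => h.
rewrite -subr_ge0 -(pmulr_rge0 _ yy_gt0); apply: le_trans h _.
by rewrite le_eqVlt; apply/orP; left; apply/eqP; ring.
Qed.

Lemma norm2D {R : realType} {n : nat} (x y : 'cV[R]_n) :
  norm2 (x + y) <= norm2 x + norm2 y.
Proof.
rewrite -(@ler_pXn2r _ 2) ?nnegrE ?addr_ge0 ?norm2_ge0 //.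
rewrite sqrrD !sqr_norm2 dotvDl !dotvDr (dotvC y x).
have := dotv_le x y; lra.
Qed.

(** The Frobenius norm of [A] bounds its action; only the existence of a bound
    is needed, to make the supremum defining [opnorm2] meaningful. *)
Lemma norm2_mulmx_frobenius {R : realType} {m n : nat} (A : 'M[R]_(m, n))
    (x : 'cV[R]_n) :
  norm2 (A *m x) <= Num.sqrt (\sum_(i < m) norm2 (row i A)^T ^+ 2) * norm2 x.
Proof.
have s_ge0 : 0 <= \sum_(i < m) norm2 (row i A)^T ^+ 2.
  by rewrite sumr_ge0 // => i _; rewrite sqr_ge0.
rewrite -(@ler_pXn2r _ 2) ?nnegrE ?mulr_ge0 ?norm2_ge0 ?sqrtr_ge0 //.
rewrite (sqr_norm2 (A *m x)) exprMn sqr_sqrtr // dotvv mulr_suml.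
apply: ler_sum => i _; rewrite -exprMn.
have -> : (A *m x) i 0 = dotv (row i A)^T x by rewrite /dotv trmxK -row_mul [in RHS]mxE.
rewrite -[leLHS]real_normK ?num_real //.
rewrite ler_pXn2r ?nnegrE ?mulr_ge0 ?norm2_ge0 // ler_norml dotv_le andbT.
rewrite lerNl -mulN1r -dotvZr; apply: le_trans (dotv_le _ _) _.
rewrite ler_pM ?norm2_ge0 //.
by rewrite -(@ler_pXn2r _ 2) ?nnegrE ?norm2_ge0 // !sqr_norm2 dotvZl dotvZr; lra.
Qed.

Lemma opnorm2_ubound {R : realType} {m n : nat} (A : 'M[R]_(m, n))
    (x : 'cV[R]_n) : norm2 x <= 1 -> norm2 (A *m x) <= opnorm2 A.
Proof.
move=> x1; apply: ub_le_sup; last by exists x.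
exists (Num.sqrt (\sum_(i < m) norm2 (row i A)^T ^+ 2)) => _ [y /= y1 <-].
apply: le_trans (norm2_mulmx_frobenius _ _) _.
by rewrite -[leRHS]mulr1 ler_wpM2l ?sqrtr_ge0.
Qed.

Lemma opnorm2_ge0 {R : realType} {m n : nat} (A : 'M[R]_(m, n)) :
  0 <= opnorm2 A.
Proof.
apply: le_trans (norm2_ge0 (A *m 0)) _.
by apply: opnorm2_ubound; rewrite norm20.
Qed.

Lemma norm2_mulmx_le {R : realType} {m n : nat} (A : 'M[R]_(m, n))
    (x : 'cV[R]_n) : norm2 (A *m x) <= opnorm2 A * norm2 x.
Proof.
have [/norm2_eq0 ->|x0] := eqVneq (norm2 x) 0.
  by rewrite mulmx0 !norm20 mulr0.
have x_gt0 : 0 < norm2 x by rewrite lt_neqAle eq_sym x0 norm2_ge0.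
have xV_ge0 : 0 <= (norm2 x)^-1 by rewrite invr_ge0 ltW.
rewrite -ler_pdivrMr // mulrC -norm2Z // scalemxAr.
by apply: opnorm2_ubound; rewrite norm2Z // mulVf.
Qed.

Lemma contraction_unitmx {R : realType} {n : nat} (K : 'M[R]_n) :
  opnorm2 K < 1 -> 1%:M - K \in unitmx.
Proof.
move=> K1; rewrite -unitmx_tr unitmxE unitfE.
apply/det0P => -[v v0 /(congr1 trmx)].
rewrite trmx_mul trmxK trmx0 mulmxBl mul1mx => /eqP; rewrite subr_eq0 => /eqP vK.
have := norm2_mulmx_le K v^T; rewrite -vK => h.
have /norm2_eq0 vT0 : norm2 v^T = 0.
  apply/eqP; rewrite eq_le norm2_ge0 andbT -(@pmulr_rle0 _ (1 - opnorm2 K)).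
    by rewrite mulrBl mul1r subr_le0.
  by rewrite subr_gt0.
by move/eqP: v0; apply; rewrite -[v]trmxK vT0 trmx0.
Qed.

Lemma norm2_proj_le {R : realType} {n r : nat} (B : 'M[R]_(n, r))
    (y : 'cV[R]_n) :
  B^T *m B = 1%:M -> norm2 (B *m B^T *m y) <= norm2 y.
Proof.
move=> hB; set p := B *m B^T *m y.
have [->|p0] := eqVneq (norm2 p) 0; first exact: norm2_ge0.
have p_gt0 : 0 < norm2 p by rewrite lt_neqAle eq_sym p0 norm2_ge0.
rewrite -(ler_pM2l p_gt0) -expr2 sqr_norm2; apply: le_trans (dotv_le p y).
(* the projector is symmetric and idempotent *)
rewrite /dotv /p !trmx_mul trmxK -!mulmxA (mulmxA B^T B) hB mul1mx.
by [].
Qed.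

Theorem theorem3p2 (R : realType) (N r : nat)
    (K : 'M[R]_N) (kappa : R)
    (hK : opnorm2 K = kappa) (hkappa : kappa < 1)
    (phi U : 'cV[R]_N) (hU : U = invmx (1%:M - K) *m phi)
    (B : 'M[R]_(N, r)) (hB : B^T *m B = 1%:M)
    (c : 'cV[R]_r) (hc : B^T *m (1%:M - K) *m B *m c = B^T *m phi)
    (Uhat : 'cV[R]_N) (hUhat : Uhat = B *m c)
    (Pi : 'M[R]_N) (hPi : Pi = B *m B^T) :
  norm2 (U - Uhat) <= (1 + kappa) / (1 - kappa) * norm2 (U - Pi *m U).
Proof.
have unitK : 1%:M - K \in unitmx by apply: contraction_unitmx; rewrite hK.
have UE : (1%:M - K) *m U = phi by rewrite hU mulKVmx.
have kappa_ge0 : 0 <= kappa by rewrite -hK opnorm2_ge0.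
set a := U - Uhat; set e := U - Pi *m U.
have galerkin : B^T *m a = B^T *m (K *m a).
  apply/eqP; rewrite -subr_eq0 -mulmxBr -{1}[a]mul1mx -mulmxBl.
  by rewrite /a mulmxBr UE mulmxBr hUhat -hc !mulmxA subrr.
have PiUhat : Pi *m Uhat = Uhat.
  by rewrite hPi hUhat -mulmxA (mulmxA B^T) hB mul1mx.
have aE : a = e + Pi *m (K *m a).
  rewrite hPi -mulmxA -galerkin mulmxA -hPi /a mulmxBr PiUhat /e.
  by rewrite addrA subrK.
have a_le : norm2 a <= norm2 e + kappa * norm2 a.
  rewrite {1}aE; apply: le_trans (norm2D _ _) _; rewrite lerD2l hPi.
  apply: le_trans (norm2_proj_le _ _ hB) _.
  by rewrite -hK norm2_mulmx_le.
rewrite mulrAC ler_pdivlMr ?subr_gt0 //.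
have := mulr_ge0 kappa_ge0 (norm2_ge0 e); lra.
Qed.
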